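(* Let $I$ be such that for any $f(x_1,\ldots,x_n)\in I$ there exists $i$ such that $x_i$ appears in each monomial of $f$. Let $A\in\mathcal{V}(I)$, let $\alpha:G\curvearrowright A$ be the partial action induced by an ideal partial representation $\pi:G\to\operatorname{End}_0(A)$, and let $\Theta:G\curvearrowright\Lambda(A)$, $\Theta_g(\lfloor h,a\rfloor)=\lfloor gh,a\rfloor$, with $\iota:A\to\Lambda(A)$, $\iota(a)=\lfloor 1,a\rfloor$, be the globalization of $\alpha$ given by the $\Lambda$-construction, where $\Lambda(A)$ has the product $\lfloor g,a\rfloor\lfloor h,b\rfloor=\lfloor g,a\,\pi_{g^{-1}h}(b)\rfloor$. Let $\Theta':G\curvearrowright B$, $B\in\mathcal{V}(I)$, with embedding $\iota':A\to B$, be a globalization of $\alpha$ such that $$\Theta'_g(\iota'(a))\,\iota'(b)=\Theta'_g(\iota'(a))\,\iota'(\pi_g\pi_{g^{-1}}(b))\quad\text{for all } g\in G,\ a,b\in A.$$ Then there exists a surjective $G$-equivariant algebra homomorphism $\varphi:\Lambda(A)\to B$ such that $\varphi\circ\iota=\iota'$.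
   Context: $K$ is an associative commutative unital ring, all modules, algebras and tensor products are over $K$, and $G$ is a group. A non-associative algebra is a $K$-module with a $K$-bilinear product, not necessarily associative or unital. $F(X)$ is the free non-associative (non-unital) $K$-algebra on a countable set $X$; for $I\subseteq F(X)$, $\mathcal{V}(I)$ is the class of all non-associative algebras satisfying all identities $f=0$, $f\in I$. $\operatorname{End}_0(A)$ is the monoid of algebra endomorphisms of $A$ (not required to preserve a unit). An ideal partial representation of $G$ on $A$ is a map $\pi:G\to\operatorname{End}_0(A)$ with $\pi_1=\mathrm{id}$, $\pi_{g^{-1}}\pi_g\pi_h=\pi_{g^{-1}}\pi_{gh}$ and $\pi_g\pi_h\pi_{h^{-1}}=\pi_{gh}\pi_{h^{-1}}$ for all $g,h\in G$, such that each $\operatorname{im}\pi_g$ is a two-sided ideal of $A$. A partial action $\alpha:G\curvearrowright A$ on an algebra $A$ consists of two-sided ideals $A_g\subseteq A$ and algebra isomorphisms $\alpha_g:A_{g^{-1}}\to A_g$ such that $A_1=A$, $\alpha_1=\mathrm{id}$; $\alpha_g(A_{g^{-1}}\cap A_{g^{-1}h})\subseteq A_g\cap A_h$; and $\alpha_g\alpha_h(x)=\alpha_{gh}(x)$ for $x\in A_{h^{-1}}\cap A_{h^{-1}g^{-1}}$. It is global if all $A_g=A$. The partial action induced by $\pi$ has $A_g=\operatorname{im}\pi_g$ and $\alpha_g=\pi_g|_{A_{g^{-1}}}$. A $G$-equivariant map between (partial) actions $\alpha$ on $A$ and $\beta$ on $B$ on algebras is an algebra homomorphism $\phi:A\to B$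 with $\phi(A_g)\subseteq B_g$ and $\phi(\alpha_g(x))=\beta_g(\phi(x))$ for $x\in A_{g^{-1}}$; it is an isomorphism if it is bijective with $G$-equivariant inverse. The restriction of a global action $\beta:G\curvearrowright B$ to an ideal $C$ of $B$ is given by $C_g=C\cap\beta_g(C)$ and the restrictions of $\beta_g$ to $C_{g^{-1}}$. A globalization of $\alpha:G\curvearrowright A$ is a pair $(\Theta',\iota')$, where $\Theta':G\curvearrowright B$ is a global action on an algebra $B\in\mathcal{V}(I)$ and $\iota':A\to B$ is an injective $G$-equivariant map, such that $\iota'(A)$ is a two-sided ideal of $B$, $\alpha$ is isomorphic to the restriction of $\Theta'$ to $\iota'(A)$, and $B=\sum_{g\in G}\Theta'_g(\iota'(A))$. $\Lambda(A)$ is the quotient of the $K$-module $KG\otimes A$ by the submodule generated by all $g\otimes\alpha_h(a)-gh\otimes a$ with $g,h\in G$, $a\in A_{h^{-1}}$; $\lfloor g,a\rfloor$ is the class of $g\otimes a$. The product on $\Lambda(A)$ and the maps $\Theta_g$ are well defined, and $(\Theta,\iota)$ is a globalization of $\alpha$ with $\Lambda(A)\in\mathcal{V}(I)$ under the stated hypothesis on $I$. *)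

(* Defs.v *)
From HB Require Import structures.
From mathcomp Require Import all_boot all_algebra finmap.
From mathcomp Require Import boolp classical_sets functions.
From mathcomp Require Import monalg.

Set Implicit Arguments.
Unset Strict Implicit.
Unset Printing Implicit Defensive.

Import GRing.Theory.

Local Open Scope classical_set_scope.
Local Open Scope quotient_scope.
Local Open Scope ring_scope.

(* The coefficient ring is a [comPzRingType]: commutative and unital, with the
   zero ring allowed. *)

HB.mixin Record Lmodule_isNonAssocAlgebra (K : comPzRingType) A
    of GRing.Lmodule K A := {
  namul : A -> A -> A;
  namul_linearl : forall y, linear (namul^~ y);
  namul_linearr : forall x, linear (namul x)
}.

#[short(type="naAlgType")]
HB.structure Definition NonAssocAlgebra (K : comPzRingType) :=
  {A of Lmodule_isNonAssocAlgebra K A & GRing.Lmodule K A}.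

Reserved Notation "x ** y" (at level 40, left associativity).
Notation "x ** y" := (namul x y) : ring_scope.

Section AlgebraNotions.
Variable K : comPzRingType.

Definition is_submod (V : lmodType K) (N : set V) : Prop :=
  N 0 /\ forall (c : K) x y, N x -> N y -> N (c *: x + y).

Definition is_ideal (A : naAlgType K) (J : set A) : Prop :=
  is_submod J /\ forall x y, J x -> J (x ** y) /\ J (y ** x).

Definition algebra_hom (A B : naAlgType K) (f : A -> B) : Prop :=
  linear f /\ {morph f : x y / x ** y}.

Definition ideal_iso (A : naAlgType K) (J J' : set A) (f : A -> A) : Prop :=
  [/\ set_bij J J' f,
      forall (c : K) x y, J x -> J y -> f (c *: x + y) = c *: f x + f y
    & forall x y, J x -> J y -> f (x ** y) = f x ** f y].

Definition sum_submod (V : lmodType K) (T : Type) (N : T -> set V) : set V :=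
  [set v | exists n (t : 'I_n -> T) (x : 'I_n -> V),
     (forall i, N (t i) (x i)) /\ v = \sum_i x i].

End AlgebraNotions.

(* Free modules.  The library's module structure on [{malg K[X]}] is only
   declared for nonzero rings, hence the alias. *)
Definition free_mod (K : comPzRingType) (X : choiceType) := {malg K[X]}.

Section FreeModule.
Variables (K : comPzRingType) (X : choiceType).
Local Notation F := (free_mod K X).

HB.instance Definition _ := GRing.Zmodule.on F.

Definition fm_basis (x : X) : F := << x >>.

Definition fm_scale (c : K) (u : F) : F := [malg x in msupp u => c * u@_x].

Lemma fm_scaleE c u x : (fm_scale c u)@_x = c * u@_x.
Proof. by rewrite mcoeffE; case: msuppP; rewrite ?mulr0. Qed.

Fact fm_scaleA c d u : fm_scale c (fm_scale d u) = fm_scale (c * d) u.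
Proof. by apply/malgP => x; rewrite !fm_scaleE mulrA. Qed.

Fact fm_scale1 : left_id 1 fm_scale.
Proof. by move=> u; apply/malgP => x; rewrite fm_scaleE mul1r. Qed.

Fact fm_scaleDr : right_distributive fm_scale +%R.
Proof. by move=> c u v; apply/malgP => x; rewrite !(mcoeffD, fm_scaleE) mulrDr. Qed.

Fact fm_scaleDl u : {morph fm_scale^~ u : c d / c + d}.
Proof. by move=> c d; apply/malgP => x; rewrite !(mcoeffD, fm_scaleE) mulrDl. Qed.

HB.instance Definition _ := GRing.Zmodule_isLmodule.Build K F
  fm_scaleA fm_scale1 fm_scaleDr fm_scaleDl.

Lemma fm_coefZ (c : K) (u : F) x : (c *: u)@_x = c * u@_x.
Proof. exact: fm_scaleE. Qed.

Lemma fm_expand (u : F) : u = \sum_(x <- msupp u) u@_x *: fm_basis x.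
Proof.
rewrite [LHS]monalgE; apply: eq_bigr => x _; apply/malgP => y.
by rewrite fm_coefZ !mcoeffU mulrnAr mulr1.
Qed.

Variable V : lmodType K.

Definition fm_lift (f : X -> V) (u : F) : V :=
  \sum_(x <- msupp u) u@_x *: f x.

Lemma fm_liftEw f (u : F) (D : {fset X}) : (msupp u `<=` D)%fset ->
  fm_lift f u = \sum_(x <- D) u@_x *: f x.
Proof.
move=> uD; rewrite /fm_lift; apply: big_fset_incl => // x _ xu.
by rewrite mcoeff_outdom // scale0r.
Qed.

Lemma fm_lift_linear f : linear (fm_lift f).
Proof.
move=> c u v; set D := (msupp u `|` msupp v `|` msupp (c *: u + v))%fset.
rewrite !(@fm_liftEw _ _ D);
  try by apply/fsubsetP => x; rewrite !in_fsetU => ->; rewrite ?orbT.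
rewrite scaler_sumr -big_split /=; apply: eq_bigr => x _.
by rewrite mcoeffD fm_coefZ scalerDl scalerA.
Qed.

Lemma fm_lift_basis f x : fm_lift f (fm_basis x) = f x.
Proof.
rewrite (fm_liftEw f (D := [fset x]%fset)) ?msuppU_le // big_seq_fset1.
by rewrite mcoeffUU scale1r.
Qed.

End FreeModule.

Section LinearFacts.
Variables (K : comPzRingType) (V W : lmodType K).

Lemma linear_map0 (f : V -> W) : linear f -> f 0 = 0.
Proof.
move=> fL; have := fL 1 0 0; rewrite !scale1r !addr0 => /(congr1 (+%R^~ (- f 0))).
by rewrite subrr addrK => <-.
Qed.

Lemma linear_mapD (f : V -> W) : linear f -> {morph f : x y / x + y}.
Proof. by move=> fL x y; have := fL 1 x y; rewrite !scale1r. Qed.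

Lemma linear_mapZ (f : V -> W) : linear f -> scalable f.
Proof. by move=> fL c x; have := fL c x 0; rewrite linear_map0 // !addr0. Qed.

Lemma linear_mapB (f : V -> W) : linear f -> {morph f : x y / x - y}.
Proof.
by move=> fL x y; rewrite -scaleN1r addrC fL addrC scaleN1r.
Qed.

Lemma eq_linear_submod (f g : V -> W) : linear f -> linear g ->
  is_submod [set v | f v = g v].
Proof.
move=> fL gL; split=> [|c x y /= fgx fgy]; first by rewrite /= !linear_map0.
by rewrite fL gL fgx fgy.
Qed.

End LinearFacts.

Lemma linear_comp (K : comPzRingType) (U V W : lmodType K) (f : V -> W)
  (g : U -> V) : linear f -> linear g -> linear (f \o g).
Proof. by move=> fL gL c x y; rewrite /= gL fL. Qed.

Lemma linear_combination (K : comPzRingType) (V W : lmodType K) (c : K)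
    (f g : V -> W) : linear f -> linear g -> linear (fun v => c *: f v + g v).
Proof.
move=> fL gL d x y; rewrite fL gL !scalerDr !scalerA (mulrC c d).
by rewrite addrACA.
Qed.

Lemma fm_ext (K : comPzRingType) (X : choiceType) (V : lmodType K)
    (f g : free_mod K X -> V) : linear f -> linear g ->
  (forall x, f (fm_basis K x) = g (fm_basis K x)) -> f =1 g.
Proof.
move=> fL gL fg u; rewrite [u]fm_expand.
elim: (finmap.enum_fset _) => [|x s IH]; first by rewrite big_nil !linear_map0.
by rewrite big_cons fL gL fg IH.
Qed.

(* [lquot S] is the quotient of [V] by the submodule generated by [S]. *)
Section Quotient.
Variables (K : comPzRingType) (V : lmodType K) (S : set V).

Definition gen_submod : set V := smallest (@is_submod K V) S.

Definition gen_submodb : V -> bool := fun v => `[< gen_submod v >].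

Lemma gen_submodP : is_submod gen_submod.
Proof.
split=> [N [] [N0 _] _ //|c x y Nx Ny N HN].
by have [[_ NL] _] := HN; apply: NL; [apply: Nx|apply: Ny].
Qed.

Fact gen_submodb_zmod : zmod_closed gen_submodb.
Proof.
have [S0 SL] := gen_submodP; split=> [|x y]; first exact/asboolP.
by move=> /asboolP Sx /asboolP Sy; apply/asboolP; rewrite addrC -scaleN1r; apply: SL.
Qed.

HB.instance Definition _ := GRing.isZmodClosed.Build V gen_submodb gen_submodb_zmod.

Definition gen_zmod : zmodClosed V := GRing.ZmodClosed.clone V gen_submodb _.

Definition lquot := Quotient.quot gen_zmod.

HB.instance Definition _ := GRing.Zmodule.on lquot.

Definition lproj (v : V) : lquot := \pi_(Quotient.quot gen_zmod) v.

Lemma lproj_eq u v : lproj u = lproj v <-> gen_submod (u - v).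
Proof.
have := @Quotient.idealrBE V gen_zmod u v.
rewrite /lproj => e; split=> [/eqP|h]; first by rewrite -e => /asboolP.
by apply/eqP; rewrite -e; apply/asboolP.
Qed.

Lemma lprojD : {morph lproj : u v / u + v}.
Proof. by move=> u v; rewrite /lproj raddfD. Qed.

Lemma lproj_surj (q : lquot) : lproj (repr q) = q.
Proof. exact: reprK. Qed.

Definition lquot_scale (c : K) (q : lquot) : lquot := lproj (c *: repr q).

Lemma lproj_scale c v : lproj (c *: v) = lquot_scale c (lproj v).
Proof.
apply/lproj_eq; rewrite -scalerBr.
have [S0 SL] := gen_submodP; rewrite -[_ *: _]addr0; apply: SL => //.
by apply/lproj_eq; rewrite lproj_surj.
Qed.

Fact lquot_scaleA c d q : lquot_scale c (lquot_scale d q) = lquot_scale (c * d) q.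
Proof. by rewrite -(lproj_surj q) -!lproj_scale scalerA. Qed.

Fact lquot_scale1 : left_id 1 lquot_scale.
Proof. by move=> q; rewrite -(lproj_surj q) -!lproj_scale scale1r. Qed.

Fact lquot_scaleDr : right_distributive lquot_scale +%R.
Proof.
move=> c q r; rewrite -(lproj_surj q) -(lproj_surj r).
by rewrite -lprojD -!lproj_scale scalerDr lprojD.
Qed.

Fact lquot_scaleDl q : {morph lquot_scale^~ q : c d / c + d}.
Proof.
by move=> c d; rewrite -(lproj_surj q) -!lproj_scale scalerDl lprojD.
Qed.

HB.instance Definition _ := GRing.Zmodule_isLmodule.Build K lquot
  lquot_scaleA lquot_scale1 lquot_scaleDr lquot_scaleDl.

Lemma lproj_linear : linear lproj.
Proof. by move=> c u v; rewrite lprojD lproj_scale. Qed.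

Variable W : lmodType K.

Definition lquot_lift (f : V -> W) (q : lquot) : W := f (repr q).

Lemma lquot_liftE f v : linear f -> (forall s, S s -> f s = 0) ->
  lquot_lift f (lproj v) = f v.
Proof.
move=> fL fS; apply/eqP; rewrite -subr_eq0 /lquot_lift -(linear_mapB fL); apply/eqP.
have /lproj_eq H := lproj_surj (lproj v).
apply: (H [set x | f x = 0]); split => //; split=> [|c x y /= fx fy].
  exact: linear_map0.
by rewrite fL fx fy scaler0 addr0.
Qed.

Lemma lquot_lift_linear f : linear f -> (forall s, S s -> f s = 0) ->
  linear (lquot_lift f).
Proof.
move=> fL fS c q r; rewrite -(lproj_surj q) -(lproj_surj r) -lproj_linear.
by rewrite !lquot_liftE // fL.
Qed.

End Quotient.

(* Unfolding these down to chosen representatives makes unification diverge. *)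
#[global] Opaque lproj lquot_lift.

Section TensorProduct.
Variables (K : comPzRingType) (M N : lmodType K).
Local Notation e m n := (fm_basis K ((m, n) : (M * N)%type)).

Definition tensor_rel : set (free_mod K (M * N)%type) :=
  [set r | [\/ exists m m' n, r = e (m + m') n - (e m n + e m' n),
               exists m n n', r = e m (n + n') - (e m n + e m n'),
               exists c m n, r = e (c *: m) n - c *: e m n
             | exists c m n, r = e m (c *: n) - c *: e m n]].

Definition tensor := lquot tensor_rel.

HB.instance Definition _ := GRing.Lmodule.on tensor.

Definition tens (m : M) (n : N) : tensor := lproj tensor_rel (e m n).

Lemma tens_rel0 r : tensor_rel r -> lproj tensor_rel r = 0.
Proof.
move=> Rr; rewrite -(linear_map0 (lproj_linear tensor_rel)).
by apply/lproj_eq; rewrite subr0 => P [_]; apply.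
Qed.

Lemma tens_linearl n : linear (tens^~ n).
Proof.
move=> c m m'; have pL := lproj_linear tensor_rel.
have /tens_rel0 : tensor_rel (e (c *: m + m') n - (e (c *: m) n + e m' n)).
  by constructor 1; do 3 eexists.
have /tens_rel0 : tensor_rel (e (c *: m) n - c *: e m n).
  by constructor 3; do 3 eexists.
rewrite !(linear_mapB pL) !(linear_mapD pL) (linear_mapZ pL).
by move=> /subr0_eq E /subr0_eq; rewrite E.
Qed.

Lemma tens_linearr m : linear (tens m).
Proof.
move=> c n n'; have pL := lproj_linear tensor_rel.
have /tens_rel0 : tensor_rel (e m (c *: n + n') - (e m (c *: n) + e m n')).
  by constructor 2; do 3 eexists.
have /tens_rel0 : tensor_rel (e m (c *: n) - c *: e m n).
  by constructor 4; do 3 eexists.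
rewrite !(linear_mapB pL) !(linear_mapD pL) (linear_mapZ pL).
by move=> /subr0_eq E /subr0_eq; rewrite E.
Qed.

Variable W : lmodType K.

Lemma tens_ext (f g : tensor -> W) : linear f -> linear g ->
  (forall m n, f (tens m n) = g (tens m n)) -> f =1 g.
Proof.
move=> fL gL fg q; rewrite -(lproj_surj q).
have pL := lproj_linear tensor_rel.
apply: (fm_ext (linear_comp fL pL) (linear_comp gL pL)) => -[m n] /=.
exact: fg.
Qed.

Definition tens_lift (f : M -> N -> W) : tensor -> W :=
  lquot_lift (fm_lift (fun p => f p.1 p.2)).

Section Lift.
Variable f : M -> N -> W.
Hypothesis fl : forall n, linear (f^~ n).
Hypothesis fr : forall m, linear (f m).

Let f0 s : tensor_rel s -> fm_lift (fun p => f p.1 p.2) s = 0.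
Proof.
have lL := @fm_lift_linear K _ W (fun p : (M * N)%type => f p.1 p.2).
case=> -[x] [y] [z] ->; rewrite (linear_mapB lL) ?(linear_mapD lL);
  rewrite ?(linear_mapZ lL) !fm_lift_basis /=; apply/eqP; rewrite subr_eq0.
- by have /= -> := linear_mapD (fl z) x y.
- by rewrite (linear_mapD (fr x)).
- by have /= -> := linear_mapZ (fl z) x y.
- by rewrite (linear_mapZ (fr y)).
Qed.

Lemma tens_lift_linear : linear (tens_lift f).
Proof. exact: lquot_lift_linear (fm_lift_linear _) f0. Qed.

Lemma tens_liftE m n : tens_lift f (tens m n) = f m n.
Proof.
by rewrite [LHS](lquot_liftE _ (fm_lift_linear _) f0) fm_lift_basis.
Qed.
End Lift.

End TensorProduct.

(* The free non-associative algebra on the variables x_0, x_1, x_2, ...: the free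
   module on the non-associative monomials, i.e. on the free magma. *)
Inductive monomial := Var of nat | Mon of monomial & monomial.

Fixpoint monomial_encode (m : monomial) : GenTree.tree nat :=
  match m with
  | Var i => GenTree.Leaf i
  | Mon m1 m2 => GenTree.Node 0 [:: monomial_encode m1; monomial_encode m2]
  end.

Fixpoint monomial_decode (t : GenTree.tree nat) : option monomial :=
  match t with
  | GenTree.Leaf i => Some (Var i)
  | GenTree.Node _ [:: t1; t2] =>
    if (monomial_decode t1, monomial_decode t2) is (Some m1, Some m2)
    then Some (Mon m1 m2) else None
  | _ => None
  end.

Lemma monomial_encodeK : pcancel monomial_encode monomial_decode.
Proof. by elim=> //= m1 -> m2 ->. Qed.

HB.instance Definition _ := Countable.copy monomial (pcan_type monomial_encodeK).

Fixpoint occurs (i : nat) (m : monomial) : bool :=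
  match m with
  | Var j => i == j
  | Mon m1 m2 => occurs i m1 || occurs i m2
  end.

Definition free_alg (K : comPzRingType) := free_mod K monomial.

Section FreeAlgebra.
Variable K : comPzRingType.

HB.instance Definition _ := GRing.Lmodule.on (free_alg K).

Definition free_alg_mul (u v : free_alg K) : free_alg K :=
  fm_lift (fun m => fm_lift (fun n => fm_basis K (Mon m n)) v) u.

Fact free_alg_mul_linearl v : linear (free_alg_mul^~ v).
Proof. exact: fm_lift_linear. Qed.

Fact free_alg_mul_linearr u : linear (free_alg_mul u).
Proof.
move=> c v w; rewrite /free_alg_mul /fm_lift scaler_sumr -big_split /=.
apply: eq_bigr => m _; rewrite -/(fm_lift _ (c *: v + w)) fm_lift_linear.
by rewrite scalerDr !scalerA mulrC.
Qed.

HB.instance Definition _ := Lmodule_isNonAssocAlgebra.Build K (free_alg K)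
  free_alg_mul_linearl free_alg_mul_linearr.

Variables (A : naAlgType K) (x : nat -> A).

Fixpoint eval_monomial (m : monomial) : A :=
  match m with
  | Var i => x i
  | Mon m1 m2 => eval_monomial m1 ** eval_monomial m2
  end.

Definition eval_free (f : free_alg K) : A := fm_lift eval_monomial f.

Lemma eval_free_var i : eval_free (fm_basis K (Var i)) = x i.
Proof. exact: fm_lift_basis. Qed.

Lemma eval_free_hom : algebra_hom eval_free.
Proof.
have eL : linear eval_free by exact: fm_lift_linear.
split=> // u v; pose f u := eval_free (u ** v); pose g u := eval_free u ** eval_free v.
have fL : linear f.
  exact: linear_comp eL (@namul_linearl K (free_alg K) v).
have gL : linear g by exact: linear_comp (namul_linearl (eval_free v)) eL.
apply: (fm_ext fL gL) => m; rewrite /f /g {f g fL gL}.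
pose f v := eval_free ((fm_basis K m : free_alg K) ** v).
pose g v := eval_free (fm_basis K m) ** eval_free v.
have fL : linear f.
  exact: linear_comp eL (@namul_linearr K (free_alg K) _).
have gL : linear g by exact: linear_comp (namul_linearr _) eL.
apply: (fm_ext fL gL) => n; rewrite /f /g.
by rewrite {1}/namul /= /free_alg_mul /eval_free !fm_lift_basis.
Qed.

End FreeAlgebra.

Definition in_variety (K : comPzRingType) (I : set (free_alg K))
    (A : naAlgType K) : Prop :=
  forall f, I f -> forall x : nat -> A, eval_free x f = 0.

(* The isomorphism of [pa_dom g^-1] onto [pa_dom g] is given by a total function
   [pa_map g], whose values outside [pa_dom g^-1] are irrelevant. *)
Record partial_action (K : comPzRingType) (G : groupType) (A : naAlgType K) :=
  PartialAction {
    pa_dom : G -> set A;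
    pa_map :> G -> A -> A;
    pa_ideal : forall g, is_ideal (pa_dom g);
    pa_iso : forall g, ideal_iso (pa_dom g^-1%g) (pa_dom g) (pa_map g);
    pa_dom1 : pa_dom 1%g = setT;
    pa_map1 : forall x, pa_map 1%g x = x;
    pa_domI : forall g h,
      pa_map g @` (pa_dom g^-1%g `&` pa_dom (g^-1 * h)%g)
        `<=` pa_dom g `&` pa_dom h;
    pa_mapM : forall g h x,
      (pa_dom h^-1%g `&` pa_dom (h^-1 * g^-1)%g) x ->
      pa_map g (pa_map h x) = pa_map (g * h)%g x
  }.

Section PartialActions.
Variables (K : comPzRingType) (G : groupType).

Definition is_global (A : naAlgType K) (alpha : partial_action G A) : Prop :=
  forall g, pa_dom alpha g = setT.

Definition equivariant (A B : naAlgType K) (alpha : partial_action G A)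
    (beta : partial_action G B) (phi : A -> B) : Prop :=
  [/\ algebra_hom phi,
      forall g, phi @` pa_dom alpha g `<=` pa_dom beta g
    & forall g x, pa_dom alpha g^-1%g x -> phi (alpha g x) = beta g (phi x)].

Definition isomorphic (A B : naAlgType K) (alpha : partial_action G A)
    (beta : partial_action G B) : Prop :=
  exists phi psi, [/\ cancel phi psi, cancel psi phi,
    equivariant alpha beta phi & equivariant beta alpha psi].

End PartialActions.

(* An ideal, regarded as an algebra. *)
Definition ideal_alg (K : comPzRingType) (B : naAlgType K) (C : set B)
  (idC : is_ideal C) := set_type C.

Section IdealAlgebra.
Variables (K : comPzRingType) (B : naAlgType K) (C : set B) (idC : is_ideal C).
Local Notation T := (ideal_alg idC).

HB.instance Definition _ := SubChoice.on T.

Fact ideal_alg_submod : subsemimod_closed (fun x => x \in C).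
Proof.
have [[C0 CL] _] := idC; split; first split.
- exact/mem_set.
- by move=> x y /set_mem Cx /set_mem Cy; apply/mem_set; rewrite -[x]scale1r; apply: CL.
- by move=> c x /set_mem Cx; apply/mem_set; rewrite -[_ *: _]addr0; apply: CL.
Qed.

HB.instance Definition _ :=
  GRing.SubChoice_isSubLmodule.Build K B _ T ideal_alg_submod.

End IdealAlgebra.

Section IdealAlgebraProduct.
Variables (K : comPzRingType) (B : naAlgType K) (C : set B) (idC : is_ideal C).
Local Notation T := (ideal_alg idC).

Fact ideal_alg_mul_mem (x y : T) : val x ** val y \in C.
Proof.
have Cx : C (val x) by exact: set_valP.
by apply/mem_set; case: (idC.2 _ (val y) Cx).
Qed.

Definition ideal_alg_mul (x y : T) : T := SigSub (ideal_alg_mul_mem x y).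

Lemma ideal_alg_valP c (x y : T) : val (c *: x + y) = c *: val x + val y.
Proof. exact: (GRing.linearP (val : T -> B)). Qed.

Fact ideal_alg_mul_linearl y : linear (ideal_alg_mul^~ y).
Proof.
move=> c x x'; apply: val_inj; rewrite ideal_alg_valP.
rewrite [LHS]/(val (c *: x + x') ** val y) ideal_alg_valP.
exact: (namul_linearl (val y)).
Qed.

Fact ideal_alg_mul_linearr x : linear (ideal_alg_mul x).
Proof.
move=> c y y'; apply: val_inj; rewrite ideal_alg_valP.
rewrite [LHS]/(val x ** val (c *: y + y')) ideal_alg_valP.
exact: (namul_linearr (val x)).
Qed.

HB.instance Definition _ := Lmodule_isNonAssocAlgebra.Build K T
  ideal_alg_mul_linearl ideal_alg_mul_linearr.

Lemma ideal_alg_valM (x y : T) : val (x ** y) = val x ** val y.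
Proof. by []. Qed.

Lemma ideal_alg_val0 : val (0 : T) = 0.
Proof. exact: (GRing.raddf0 (val : T -> B)). Qed.
End IdealAlgebraProduct.

Section GlobalActions.
Variables (K : comPzRingType) (G : groupType) (B : naAlgType K).
Variables (beta : partial_action G B) (gl : is_global beta).

Lemma global_linear g : linear (beta g).
Proof.
move=> c x y; have [_ L _] := pa_iso beta g.
by apply: L; rewrite gl.
Qed.

Lemma global_mul g : {morph beta g : x y / x ** y}.
Proof.
move=> x y; have [_ _ M] := pa_iso beta g.
by apply: M; rewrite gl.
Qed.

Lemma global_comp g h x : beta g (beta h x) = beta (g * h)%g x.
Proof. by apply: pa_mapM; rewrite !gl. Qed.

Lemma global_VK g x : beta g^-1%g (beta g x) = x.
Proof. by rewrite global_comp mulVg pa_map1. Qed.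

Lemma global_KV g x : beta g (beta g^-1%g x) = x.
Proof. by rewrite global_comp mulgV pa_map1. Qed.

End GlobalActions.

Section Restriction.
Variables (K : comPzRingType) (G : groupType) (B : naAlgType K).
Variables (beta : partial_action G B) (gl : is_global beta).
Variables (C : set B) (idC : is_ideal C).
Local Notation T := (ideal_alg idC).

Definition restr_dom (g : G) : set T :=
  [set x | (C `&` beta g @` C) (val x)].

(* The default value [x] is used only when [beta g (val x)] is not in [C]. *)
Definition restr_map (g : G) (x : T) : T := insubd x (beta g (val x)).

Lemma restr_domE g (x : T) :
  restr_dom g x <-> C (beta g^-1%g (val x)).
Proof.
split=> [[_ [y Cy <-]]|Cx]; first by rewrite global_VK.
split; first exact: set_valP.
by exists (beta g^-1%g (val x)); rewrite ?global_KV.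
Qed.

Lemma restr_mapE g (x : T) : C (beta g (val x)) ->
  val (restr_map g x) = beta g (val x).
Proof. by move=> Cx; rewrite val_insubd mem_set. Qed.

Fact restr_ideal g : is_ideal (restr_dom g).
Proof.
have [[C0 CL] CM] := idC; have bL := global_linear gl g^-1%g.
split; first split.
- by apply/restr_domE; rewrite ideal_alg_val0 linear_map0.
- move=> c x y /restr_domE Cx /restr_domE Cy; apply/restr_domE.
  by rewrite ideal_alg_valP bL; apply: CL.
- move=> x y /restr_domE Cx; split; apply/restr_domE;
    by rewrite ideal_alg_valM (global_mul gl); case: (CM _ (beta g^-1%g (val y)) Cx).
Qed.

Fact restr_iso g :
  ideal_iso (restr_dom g^-1%g) (restr_dom g) (restr_map g).
Proof.
have inC (x : T) : restr_dom g^-1%g x -> C (beta g (val x)).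
  by move=> /restr_domE; rewrite invgK.
have [[C0 CL] CM] := idC; split; first split.
- move=> x /inC Cx; apply/restr_domE.
  by rewrite restr_mapE // (global_VK gl); exact: set_valP.
- move=> x y /set_mem/inC Cx /set_mem/inC Cy /(congr1 val).
  rewrite !restr_mapE // => /(congr1 (beta g^-1%g)).
  by rewrite !(global_VK gl) => /val_inj.
- move=> x /restr_domE Cx.
  pose y : T := SigSub (mem_set Cx); exists y.
    by apply/restr_domE; rewrite invgK /= (global_KV gl); exact: set_valP.
  apply: val_inj; rewrite restr_mapE /= (global_KV gl) //; exact: set_valP.
- move=> c x y /inC Cx /inC Cy; apply: val_inj.
  have E : beta g (val (c *: x + y)) = c *: beta g (val x) + beta g (val y).
    by rewrite ideal_alg_valP (global_linear gl).
  by rewrite ideal_alg_valP !restr_mapE // E; exact: CL.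
- move=> x y /inC Cx /inC Cy; apply: val_inj.
  have E : beta g (val (x ** y)) = beta g (val x) ** beta g (val y).
    by rewrite ideal_alg_valM (global_mul gl).
  by rewrite ideal_alg_valM !restr_mapE // E; case: (CM _ (beta g (val y)) Cx).
Qed.

Fact restr_dom1 : restr_dom 1%g = setT.
Proof.
apply/seteqP; split=> // x _; apply/restr_domE.
by rewrite invg1 pa_map1; exact: set_valP.
Qed.

Fact restr_map1 x : restr_map 1%g x = x.
Proof.
by apply: val_inj; rewrite restr_mapE pa_map1 //; exact: set_valP.
Qed.

Fact restr_domI g h :
  restr_map g @` (restr_dom g^-1%g `&` restr_dom (g^-1 * h)%g)
    `<=` restr_dom g `&` restr_dom h.
Proof.
move=> _ [x [/restr_domE + /restr_domE +] <-]; rewrite invgK => Cg Ch.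
split; apply/restr_domE; rewrite restr_mapE //.
  by rewrite (global_VK gl); exact: set_valP.
by rewrite (global_comp gl); rewrite invgM invgK in Ch.
Qed.

Fact restr_mapM g h x :
  (restr_dom h^-1%g `&` restr_dom (h^-1 * g^-1)%g) x ->
  restr_map g (restr_map h x) = restr_map (g * h)%g x.
Proof.
move=> [/restr_domE + /restr_domE +]; rewrite -invgM !invgK => Ch Cgh.
have E := restr_mapE Ch.
apply: val_inj; rewrite (restr_mapE Cgh).
by rewrite restr_mapE E (global_comp gl).
Qed.

Definition restriction : partial_action G T :=
  PartialAction restr_ideal restr_iso restr_dom1 restr_map1 restr_domI
    restr_mapM.

End Restriction.

Record globalization (K : comPzRingType) (G : groupType) (I : set (free_alg K))
    (A B : naAlgType K) (alpha : partial_action G A)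
    (Theta : partial_action G B) (iota : A -> B) : Prop := Globalization {
  glob_variety : in_variety I B;
  glob_global : is_global Theta;
  glob_inj : injective iota;
  glob_equiv : equivariant alpha Theta iota;
  glob_ideal : is_ideal (range iota);
  glob_restr : isomorphic alpha (restriction glob_global glob_ideal);
  glob_span : sum_submod (fun g => Theta g @` range iota) = setT
}.

Record ideal_partial_rep (K : comPzRingType) (G : groupType) (A : naAlgType K) :=
  IdealPartialRep {
    rep_map :> G -> A -> A;
    rep_hom : forall g, algebra_hom (rep_map g);
    rep1 : forall a, rep_map 1%g a = a;
    repVl : forall g h a,
      rep_map g^-1%g (rep_map g (rep_map h a)) =
      rep_map g^-1%g (rep_map (g * h)%g a);
    repVr : forall g h a,
      rep_map g (rep_map h (rep_map h^-1%g a)) =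
      rep_map (g * h)%g (rep_map h^-1%g a);
    rep_ideal : forall g, is_ideal (range (rep_map g))
  }.

Section InducedPartialAction.
Variables (K : comPzRingType) (G : groupType) (A : naAlgType K).
Variable pi : ideal_partial_rep G A.

Lemma repK g a : pi g (pi g^-1%g (pi g a)) = pi g a.
Proof. by have := repVr pi g g^-1%g a; rewrite invgK mulgV rep1. Qed.

Lemma rep_rangeK g a : range (pi g) a -> pi g (pi g^-1%g a) = a.
Proof. by move=> [b _ <-]; rewrite repK. Qed.

Lemma rep_rangeVK g a : range (pi g^-1%g) a -> pi g^-1%g (pi g a) = a.
Proof. by move=> /rep_rangeK; rewrite invgK. Qed.

Lemma rep_comp g h a : range (pi h^-1%g) a -> pi g (pi h a) = pi (g * h)%g a.
Proof. by move=> [b _ <-]; rewrite repVr. Qed.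

Lemma repVl' g h a :
  pi g (pi g^-1%g (pi h a)) = pi g (pi (g^-1 * h)%g a).
Proof. by have := repVl pi g^-1%g h a; rewrite invgK. Qed.

Lemma rep_idem_shift g h a :
  pi g (pi h (pi h^-1%g a)) = pi (g * h)%g (pi (g * h)^-1%g (pi g a)).
Proof. by rewrite repVr -[LHS]repK repVl -mulgA mulgV mulg1. Qed.

Lemma rep_idemC g h a :
  pi g (pi g^-1%g (pi h (pi h^-1%g a))) = pi h (pi h^-1%g (pi g (pi g^-1%g a))).
Proof. by rewrite (rep_idem_shift g^-1%g) rep_idem_shift mulgA mulgV mul1g. Qed.

Fact induced_iso g : ideal_iso (range (pi g^-1%g)) (range (pi g)) (pi g).
Proof.
have [L M] := rep_hom pi g; split; [split| |].
- by move=> a _; exists a.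
- move=> a b /set_mem/rep_rangeVK Ea /set_mem/rep_rangeVK Eb E.
  by rewrite -Ea -Eb E.
- move=> _ [b _ <-]; exists (pi g^-1%g (pi g b)); last exact: repK.
  by exists (pi g b).
- by move=> *; apply: L.
- by move=> *; apply: M.
Qed.

Fact induced_dom1 : range (pi 1%g) = setT.
Proof. by apply/seteqP; split=> // a _; exists a => //; rewrite rep1. Qed.

Fact induced_domI g h :
  pi g @` (range (pi g^-1%g) `&` range (pi (g^-1 * h)%g))
    `<=` range (pi g) `&` range (pi h).
Proof.
move=> _ [a [_ /rep_rangeK Ea] <-]; split; first by exists a.
rewrite -Ea rep_idem_shift mulgA mulgV mul1g.
by exists (pi h^-1%g (pi g a)).
Qed.

Fact induced_mapM g h a :
  (range (pi h^-1%g) `&` range (pi (h^-1 * g^-1)%g)) a ->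
  pi g (pi h a) = pi (g * h)%g a.
Proof. by move=> [/rep_comp]. Qed.

Definition induced : partial_action G A :=
  PartialAction (rep_ideal pi) induced_iso induced_dom1 (rep1 pi) induced_domI
    induced_mapM.

End InducedPartialAction.

Section LambdaModule.
Variables (K : comPzRingType) (G : groupType) (A : naAlgType K).
Variable alpha : partial_action G A.
Local Notation ts g a := (@tens K (free_mod K G) A (@fm_basis K G g) a).

Definition Lambda_rel : set (tensor (free_mod K G) A) :=
  [set r | exists (g h : G) (a : A), pa_dom alpha h^-1%g a /\
             r = ts g (alpha h a) - ts (g * h)%g a].

Definition Lambda_mod := lquot Lambda_rel.

HB.instance Definition _ := GRing.Lmodule.on Lambda_mod.

Definition class_of (g : G) (a : A) : Lambda_mod := lproj Lambda_rel (ts g a).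

Lemma class_of_linear g : linear (class_of g).
Proof. exact: linear_comp (lproj_linear _) (tens_linearr _). Qed.

Lemma class_of_shift g h a : pa_dom alpha h^-1%g a ->
  class_of g (alpha h a) = class_of (g * h)%g a.
Proof.
by move=> Ha; apply/lproj_eq => N [_]; apply; exists g, h, a.
Qed.

Variable W : lmodType K.

Lemma Lambda_ext (f f' : Lambda_mod -> W) : linear f -> linear f' ->
  (forall g a, f (class_of g a) = f' (class_of g a)) -> f =1 f'.
Proof.
move=> fL fL' E q; rewrite -(lproj_surj q).
have pL := lproj_linear Lambda_rel.
apply: (tens_ext (linear_comp fL pL) (linear_comp fL' pL)) => u a /=.
have tL := tens_linearl (M := free_mod K G) a.
apply: (fm_ext (linear_comp (linear_comp fL pL) tL)
               (linear_comp (linear_comp fL' pL) tL)) => g /=.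
exact: E.
Qed.

Definition Lambda_lift (f : G -> A -> W) : Lambda_mod -> W :=
  lquot_lift (tens_lift (fun (u : free_mod K G) a => fm_lift (f^~ a) u)).

Section Lift.
Variable f : G -> A -> W.
Hypothesis fL : forall g, linear (f g).
Hypothesis fS : forall g h a, pa_dom alpha h^-1%g a ->
  f g (alpha h a) = f (g * h)%g a.

Let fl (a : A) : linear (fun u : free_mod K G => fm_lift (f^~ a) u).
Proof. exact: fm_lift_linear. Qed.

Let fr (u : free_mod K G) : linear (fun a : A => fm_lift (f^~ a) u).
Proof.
move=> c a b; rewrite /fm_lift scaler_sumr -big_split /=.
apply: eq_bigr => g _; rewrite fL scalerDr !scalerA; congr (_ *: _ + _).
exact: mulrC.
Qed.

Let lift_ts g a :
  tens_lift (fun (u : free_mod K G) a => fm_lift (f^~ a) u) (ts g a) = f g a.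
Proof. by rewrite [LHS](tens_liftE fl fr) [LHS]fm_lift_basis. Qed.

Let f0 r : Lambda_rel r ->
  tens_lift (fun (u : free_mod K G) a => fm_lift (f^~ a) u) r = 0.
Proof.
move=> [g [h [a [Ha ->]]]].
rewrite [LHS](linear_mapB (tens_lift_linear fl fr)).
apply/eqP; rewrite subr_eq0; apply/eqP.
exact: etrans (lift_ts g (alpha h a))
  (etrans (fS g Ha) (esym (lift_ts (g * h)%g a))).
Qed.

Lemma Lambda_lift_linear : linear (Lambda_lift f).
Proof. exact: lquot_lift_linear (tens_lift_linear fl fr) f0. Qed.

Lemma Lambda_liftE g a : Lambda_lift f (class_of g a) = f g a.
Proof.
rewrite [LHS](lquot_liftE _ (tens_lift_linear fl fr) f0).
exact: lift_ts.
Qed.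
End Lift.

End LambdaModule.

Definition Lambda (K : comPzRingType) (G : groupType) (A : naAlgType K)
  (pi : ideal_partial_rep G A) := Lambda_mod (induced pi).

Section LambdaAlgebra.
Variables (K : comPzRingType) (G : groupType) (A : naAlgType K).
Variable pi : ideal_partial_rep G A.

HB.instance Definition _ := GRing.Lmodule.on (Lambda pi).

Definition Lambda_class (g : G) (a : A) : Lambda pi := class_of (induced pi) g a.

Lemma Lambda_class_linear g : linear (Lambda_class g).
Proof. exact: class_of_linear. Qed.

Lemma Lambda_class_shift g h a : range (pi h^-1%g) a ->
  Lambda_class g (pi h a) = Lambda_class (g * h)%g a.
Proof. exact: (@class_of_shift _ _ _ (induced pi)). Qed.

Definition Lambda_mull (g : G) (a : A) : Lambda pi -> Lambda pi :=
  @Lambda_lift K G A (induced pi) (Lambda pi)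
    (fun h b => Lambda_class g (a ** pi (g^-1 * h)%g b)).

Definition Lambda_mul (u v : Lambda pi) : Lambda pi :=
  @Lambda_lift K G A (induced pi) (Lambda pi -> Lambda pi) Lambda_mull u v.

Let gL g a h : linear (fun b => Lambda_class g (a ** pi (g^-1 * h)%g b)).
Proof.
have [piL _] := rep_hom pi (g^-1 * h)%g.
exact: linear_comp (linear_comp (Lambda_class_linear g) (namul_linearr a)) piL.
Qed.

Let gS g a h k b : pa_dom (induced pi) k^-1%g b ->
  Lambda_class g (a ** pi (g^-1 * h)%g (induced pi k b)) =
  Lambda_class g (a ** pi (g^-1 * (h * k))%g b).
Proof. by move=> Hb /=; rewrite rep_comp ?mulgA. Qed.

Lemma Lambda_mull_linear g a : linear (Lambda_mull g a).
Proof. exact: Lambda_lift_linear (gL g a) (gS g a). Qed.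

Lemma Lambda_mullE g a h b :
  Lambda_mull g a (Lambda_class h b) = Lambda_class g (a ** pi (g^-1 * h)%g b).
Proof. exact: Lambda_liftE (gL g a) (gS g a) h b. Qed.

Let mullL g c a b v :
  Lambda_mull g (c *: a + b) v = c *: Lambda_mull g a v + Lambda_mull g b v.
Proof.
have L := Lambda_mull_linear g.
move: v; apply: (Lambda_ext (L _) (linear_combination c (L a) (L b))) => h x.
have -> := Lambda_mullE g (c *: a + b) h x.
have -> := Lambda_mullE g a h x; have -> := Lambda_mullE g b h x.
rewrite -Lambda_class_linear; congr Lambda_class.
exact: (namul_linearl (pi (g^-1 * h)%g x)).
Qed.

Let mL g : linear (Lambda_mull g).
Proof. by move=> c a b; apply/funext => v; exact: mullL. Qed.

Let mS g h a : pa_dom (induced pi) h^-1%g a ->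
  Lambda_mull g (induced pi h a) = Lambda_mull (g * h)%g a.
Proof.
move=> Ha; apply/funext; apply: Lambda_ext => [||k b].
- exact: Lambda_mull_linear.
- exact: Lambda_mull_linear.
rewrite !Lambda_mullE /= -Lambda_class_shift; last first.
  by case: ((rep_ideal pi h^-1%g).2 _ (pi ((g * h)^-1 * k)%g b) Ha).
have [_ piM] := rep_hom pi h; rewrite piM invgM -mulgA -repVl'.
have Hpa : range (pi h) (pi h a) by exists a.
have [Hab _] := (rep_ideal pi h).2 _ (pi (g^-1 * k)%g b) Hpa.
rewrite -[in LHS](rep_rangeK Hab); congr Lambda_class.
have [_ piVM] := rep_hom pi h^-1%g.
by rewrite piVM piM (rep_rangeK Hpa).
Qed.

Fact Lambda_mul_linearl v : linear (Lambda_mul^~ v).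
Proof.
by move=> c u u'; rewrite /Lambda_mul (Lambda_lift_linear mL mS).
Qed.

Lemma Lambda_mul_classl g a v : Lambda_mul (Lambda_class g a) v = Lambda_mull g a v.
Proof. by rewrite /Lambda_mul (Lambda_liftE mL mS). Qed.

Fact Lambda_mul_linearr u : linear (Lambda_mul u).
Proof.
move=> c v v'; move: u.
have L w := Lambda_mul_linearl w.
apply: (Lambda_ext (L _) (linear_combination c (L v) (L v'))) => g a.
have -> := Lambda_mul_classl g a (c *: v + v').
have -> := Lambda_mul_classl g a v; have -> := Lambda_mul_classl g a v'.
exact: Lambda_mull_linear.
Qed.

HB.instance Definition _ := Lmodule_isNonAssocAlgebra.Build K (Lambda pi)
  Lambda_mul_linearl Lambda_mul_linearr.

Lemma Lambda_classM g h a b : Lambda_class g a ** Lambda_class h b =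
  Lambda_class g (a ** pi (g^-1 * h)%g b).
Proof. by rewrite -Lambda_mullE -Lambda_mul_classl. Qed.

Definition Theta_map (g : G) : Lambda pi -> Lambda pi :=
  @Lambda_lift K G A (induced pi) (Lambda pi)
    (fun h a => Lambda_class (g * h)%g a).

Let tL g h : linear (fun a => Lambda_class (g * h)%g a).
Proof. exact: Lambda_class_linear. Qed.

Let tS g h k a : pa_dom (induced pi) k^-1%g a ->
  Lambda_class (g * h)%g (induced pi k a) = Lambda_class (g * (h * k))%g a.
Proof. by move=> Ha; rewrite mulgA Lambda_class_shift. Qed.

Lemma Theta_linear g : linear (Theta_map g).
Proof. exact: Lambda_lift_linear (tL g) (tS g). Qed.

Lemma Theta_class g h a : Theta_map g (Lambda_class h a) = Lambda_class (g * h)%g a.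
Proof. exact: Lambda_liftE (tL g) (tS g) h a. Qed.

Lemma Theta_comp g h u : Theta_map g (Theta_map h u) = Theta_map (g * h)%g u.
Proof.
move: u; apply: (Lambda_ext (linear_comp (Theta_linear g) (Theta_linear h))
  (Theta_linear (g * h)%g)) => k a /=.
have -> := Theta_class h k a; have -> := Theta_class (g * h)%g k a.
by rewrite -mulgA; exact: Theta_class.
Qed.

Fact Theta1 u : Theta_map 1%g u = u.
Proof.
move: u; apply: (Lambda_ext (Theta_linear 1%g)) => // k a.
by rewrite Theta_class mul1g.
Qed.

Lemma Theta_mul g : {morph Theta_map g : u v / u ** v}.
Proof.
have L := Theta_linear g.
move=> u v; move: u; apply: (Lambda_ext (linear_comp L (namul_linearl v))
  (linear_comp (namul_linearl (Theta_map g v)) L)) => h a /=.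
move: v; apply: (Lambda_ext (linear_comp L (namul_linearr _))
  (linear_comp (namul_linearr _) L)) => k b /=.
rewrite [LHS](congr1 (Theta_map g) (Lambda_classM h k a b)) [LHS]Theta_class.
rewrite [RHS](congr2 namul (Theta_class g h a) (Theta_class g k b)).
by rewrite [RHS]Lambda_classM invgM -mulgA mulKg.
Qed.

Fact Theta_ideal (g : G) : is_ideal (@setT (Lambda pi)).
Proof. by []. Qed.

Lemma Theta_VK g u : Theta_map g^-1%g (Theta_map g u) = u.
Proof. by rewrite Theta_comp mulVg Theta1. Qed.

Lemma Theta_KV g u : Theta_map g (Theta_map g^-1%g u) = u.
Proof. by rewrite Theta_comp mulgV Theta1. Qed.

Fact Theta_iso g : ideal_iso setT setT (Theta_map g).
Proof.
split; [split; [by move=> u _| |]| |].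
- by move=> u v _ _ E; rewrite -(Theta_VK g u) E Theta_VK.
- by move=> u _; exists (Theta_map g^-1%g u); [|exact: Theta_KV].
- by move=> c u v _ _; exact: Theta_linear.
- by move=> u v _ _; exact: Theta_mul.
Qed.

Definition Lambda_action : partial_action G (Lambda pi) :=
  @PartialAction K G (Lambda pi) (fun=> setT) Theta_map Theta_ideal Theta_iso
    (erefl _) Theta1 (fun _ _ _ _ => conj Logic.I Logic.I)
    (fun g h u _ => Theta_comp g h u).

Lemma Lambda_action_global : is_global Lambda_action.
Proof. by []. Qed.

Definition Lambda_iota (a : A) : Lambda pi := Lambda_class 1%g a.

End LambdaAlgebra.

(* Main.v *)
Require Import Defs.
From mathcomp Require Import all_boot all_algebra finmap.
From mathcomp Require Import boolp classical_sets functions.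
From mathcomp Require Import monalg.

Local Open Scope classical_set_scope.
Local Open Scope ring_scope.

(** The only candidate for [phi] sends the class of [(g, a)] to
    [Theta' g (iota' a)], since a [phi] as required is equivariant and extends
    [iota'].  It respects the relations of [Lambda] because [iota'] is
    equivariant and [Theta'] is an action, and it is onto because the
    translates of the image of [iota'] span [B].

    Multiplicativity is where the hypothesis on the products enters.  On the
    classes of [(g, a)] and [(h, b)], after translating by [g^-1], it amounts to
    [iota' a ** Theta' k (iota' b) = iota' a ** iota' (pi k b)] for [k = g^-1 h]
    ([globalization_mulE]).  That hypothesis, at [k^-1] and translated by [k],
    replaces [b] on the left by [pi k^-1 (pi k b)], an element of the domain of
    the partial action at [k]; there [Theta' k] and [pi k] agree along [iota'],
    and [pi k (pi k^-1 (pi k b)) = pi k b]. *)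

Section LambdaToGlobalization.
Variables (K : comPzRingType) (G : groupType) (A B : naAlgType K).
Variable pi : ideal_partial_rep G A.
Variables (Theta' : partial_action G B) (iota' : A -> B).
Hypothesis gl : is_global Theta'.
Hypothesis iotaE : equivariant (induced pi) Theta' iota'.

Let translate_linear g : linear (fun a => Theta' g (iota' a)).
Proof.
by have [[iotaL _] _ _] := iotaE; exact: linear_comp (global_linear gl g) iotaL.
Qed.

Let translate_shift g h a : pa_dom (induced pi) h^-1%g a ->
  Theta' g (iota' (induced pi h a)) = Theta' (g * h)%g (iota' a).
Proof.
by have [_ _ iotaG] := iotaE; move=> /iotaG ->; exact: (global_comp gl).
Qed.

Definition Lambda_map : Lambda pi -> B :=
  @Lambda_lift K G A (induced pi) B (fun g a => Theta' g (iota' a)).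

Lemma Lambda_map_linear : linear Lambda_map.
Proof. exact: Lambda_lift_linear translate_linear translate_shift. Qed.

Lemma Lambda_map_class g a : Lambda_map (Lambda_class pi g a) = Theta' g (iota' a).
Proof. exact: Lambda_liftE translate_linear translate_shift g a. Qed.

Lemma Lambda_map_iota : Lambda_map \o Lambda_iota pi = iota'.
Proof. by apply/funext => a /=; rewrite Lambda_map_class pa_map1. Qed.

Lemma Lambda_map_Theta g u : Lambda_map (Theta_map g u) = Theta' g (Lambda_map u).
Proof.
move: u; apply: (Lambda_ext (linear_comp Lambda_map_linear (@Theta_linear _ _ _ pi g))
  (linear_comp (global_linear gl g) Lambda_map_linear)) => h a /=.
rewrite [LHS](congr1 Lambda_map (Theta_class pi g h a)) [LHS]Lambda_map_class.
rewrite [RHS](congr1 (Theta' g) (Lambda_map_class h a)).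
by rewrite (global_comp gl).
Qed.

Lemma Lambda_map_surj :
    sum_submod (fun g => Theta' g @` range iota') = setT ->
  forall b, exists u, Lambda_map u = b.
Proof.
move=> spanB b.
have [n [t [x [xP ->]]]] : sum_submod (fun g => Theta' g @` range iota') b.
  by rewrite spanB.
apply: (big_ind (fun b => exists u, Lambda_map u = b)) => [|_ _ [u <-] [v <-]|i _].
- by exists 0; exact: linear_map0 Lambda_map_linear.
- by exists (u + v); exact: linear_mapD Lambda_map_linear u v.
- by have [_ [a _ <-] <-] := xP i; exists (Lambda_class pi (t i) a);
    exact: Lambda_map_class.
Qed.

Hypothesis mulH : forall (g : G) (a b : A),
  Theta' g (iota' a) ** iota' b =
  Theta' g (iota' a) ** iota' (pi g (pi g^-1%g b)).

(** The mirror image of the hypothesis: applying [Theta' k] to its instance at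
    [k^-1] moves the group element to the right-hand factor, where the
    projection [pi k^-1 \o pi k] is absorbed. *)
Lemma globalization_mulE k a b :
  iota' a ** Theta' k (iota' b) = iota' a ** iota' (pi k b).
Proof.
have [_ _ iotaG] := iotaE.
have := congr1 (Theta' k) (mulH k^-1%g a b).
rewrite !(global_mul gl) !(global_KV gl) invgK => ->.
rewrite -iotaG /=; last by exists (pi k b).
by rewrite repK.
Qed.

Lemma Lambda_map_mul : {morph Lambda_map : u v / u ** v}.
Proof.
have L := Lambda_map_linear.
move=> u v; move: u; apply: (Lambda_ext (linear_comp L (namul_linearl v))
  (linear_comp (namul_linearl (Lambda_map v)) L)) => g a /=.
move: v; apply: (Lambda_ext (linear_comp L (namul_linearr _))
  (linear_comp (namul_linearr _) L)) => h b /=.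
rewrite [LHS](congr1 Lambda_map (Lambda_classM pi g h a b)) [LHS]Lambda_map_class.
rewrite [RHS](congr2 namul (Lambda_map_class g a) (Lambda_map_class h b)).
have [[_ iotaM] _ _] := iotaE.
rewrite iotaM -globalization_mulE (global_mul gl) (global_comp gl).
by rewrite mulgA mulgV mul1g.
Qed.

End LambdaToGlobalization.

Theorem proposition2p10 (K : comPzRingType) (G : groupType)
    (I : set (free_alg K))
    (HI : forall f, I f ->
       exists i : nat, forall m : monomial, m \in msupp f -> occurs i m)
    (A : naAlgType K) (HA : in_variety I A) (pi : ideal_partial_rep G A)
    (B : naAlgType K) (Theta' : partial_action G B) (iota' : A -> B)
    (Hglob : globalization I (induced pi) Theta' iota')
    (Hmul : forall (g : G) (a b : A),
       Theta' g (iota' a) ** iota' b =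
       Theta' g (iota' a) ** iota' (pi g (pi g^-1%g b))) :
  exists phi : Lambda pi -> B,
    [/\ forall b : B, exists u : Lambda pi, phi u = b,
        equivariant (Lambda_action pi) Theta' phi
      & phi \o Lambda_iota pi = iota'].
Proof.
have [_ gl _ iotaE _ _ spanB] := Hglob.
exists (Lambda_map K G A B pi Theta' iota'); split.
- exact: Lambda_map_surj.
- split=> [|g b _|g u _]; last exact: Lambda_map_Theta.
  + by split; [exact: Lambda_map_linear | exact: Lambda_map_mul].
  + by rewrite gl.
- exact: Lambda_map_iota.
Qed.
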